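(* Let $(A,B)$ be a suitable pair of $k$-tuples, with compound sequence $G(A,B)=(g_0,\dots,g_k)$, and fix an integer $j$ with $0\le j\le k$. Let \[U_{j,0}=\Big\{\sum_{i=0}^k n_ig_i : n_j=0,\ 0\le n_i<b_{i+1}\text{ for }0\le i<j,\ 0\le n_i<a_i\text{ for }j<i\le k\Big\}.\] Then for any function $f$ defined on the non-negative integers, \[\sum_{n\in \mathit{NR}(A,B)}\big[f(n+g_j)-f(n)\big]=\sum_{n\in U_{j,0}}f(n)-\sum_{n=0}^{g_j-1}f(n).\]
   Context: Let $\mathbb{N}$ be the positive integers and $\mathbb{N}_0$ the non-negative integers. For $k\in\mathbb{N}_0$, a pair $A=(a_1,\dots,a_k)$, $B=(b_1,\dots,b_k)\in\mathbb{N}^k$ is called suitable if $\gcd(a_i,b_j)=1$ for all $i\ge j$. Its compound sequence $G(A,B)=(g_0,\dots,g_k)$ is defined by $g_0=\prod_{i=1}^k a_i$ and $g_i=g_{i-1}b_i/a_i$, i.e. $g_i=b_1\cdots b_ia_{i+1}\cdots a_k$. $R(A,B)$ denotes the set of non-negative integer linear combinations of $g_0,\dots,g_k$, and $\mathit{NR}(A,B)=\mathbb{N}_0\setminus R(A,B)$ (a finite set). *)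

(* Defs.v *)
From mathcomp Require Import all_boot all_order all_algebra.
From mathcomp Require Import all_classical.
From mathcomp Require Import zify ring.

Set Implicit Arguments.
Unset Strict Implicit.
Unset Printing Implicit Defensive.

Local Open Scope nat_scope.
Local Open Scope classical_set_scope.

(* 1-based indexing: for A = (a_1, ..., a_k), [entry A i] is a_i when
   1 <= i <= k; values outside this range are junk. *)
Definition entry (k : nat) (A : k.-tuple nat) (i : nat) : nat := nth 0 A i.-1.

Definition suitable (k : nat) (A B : k.-tuple nat) : Prop :=
  [/\ forall i, 1 <= i <= k -> 0 < entry A i,
      forall i, 1 <= i <= k -> 0 < entry B i
    & forall i j, 1 <= j -> j <= i -> i <= k -> coprime (entry A i) (entry B j)].

Definition compound (k : nat) (A B : k.-tuple nat) (i : nat) : nat :=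
  (\prod_(1 <= l < i.+1) entry B l) * (\prod_(i.+1 <= l < k.+1) entry A l).

Definition representable (k : nat) (A B : k.-tuple nat) : set nat :=
  [set n | exists c : 'I_k.+1 -> nat, n = \sum_(i < k.+1) c i * compound A B i].

Definition NR (k : nat) (A B : k.-tuple nat) : set nat :=
  ~` representable A B.

Definition U0 (k : nat) (A B : k.-tuple nat) (j : 'I_k.+1) : set nat :=
  [set n | exists c : 'I_k.+1 -> nat,
    [/\ c j = 0,
        forall i : 'I_k.+1, i < j -> c i < entry B i.+1,
        forall i : 'I_k.+1, j < i -> c i < entry A i
      & n = \sum_(i < k.+1) c i * compound A B i]].

Lemma compound0 (k : nat) (A B : k.-tuple nat) :
  compound A B 0 = \prod_(1 <= i < k.+1) entry A i.
Proof. by rewrite /compound big_geq // mul1n. Qed.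

Lemma compoundS (k : nat) (A B : k.-tuple nat) (i : nat) :
  suitable A B -> i < k ->
  compound A B i.+1 = compound A B i * entry B i.+1 %/ entry A i.+1.
Proof.
move=> [A0 _ _] ik; rewrite /compound big_nat_recr //= (@big_ltn _ _ _ i.+1 k.+1) //.
have a0 : 0 < entry A i.+1 by apply: A0.
apply/eqP; rewrite eqn_div //; last first.
  by rewrite mulnAC dvdn_mull // dvdn_mulr.
by apply/eqP; ring.
Qed.

(* [\sum_(n \in D) F n] is 0 when F has infinite support on D; the next two
   facts show that this convention plays no role for D = NR or D = U0. *)
Lemma finite_NR (k : nat) (A B : k.-tuple nat) :
  suitable A B -> finite_set (NR A B).
Proof.
move=> [A0 B0 AB].
have R0 : representable A B 0.
  by exists (fun=> 0); rewrite big1 // => i _; rewrite mul0n.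
have RD m n : representable A B m -> representable A B n ->
    representable A B (m + n).
  move=> [c ->] [d ->]; exists (fun i => c i + d i).
  by rewrite -big_split; apply: eq_bigr => i _; rewrite /= mulnDl.
have RM m n : representable A B m -> representable A B (n * m).
  by move=> Rm; elim: n => // n IHn; rewrite mulSn; exact: RD.
have Rg i : i <= k -> representable A B (compound A B i).
  move=> ik; exists (fun l : 'I_k.+1 => (l == inord i :> 'I_k.+1) : nat).
  rewrite (bigD1 (inord i)) //= eqxx mul1n inordK // big1 ?addn0 // => l.
  by move=> /negPf ->.
have gen s : (forall x, x \in s -> representable A B x) ->
    exists M, forall n, M <= n -> foldr gcdn 0 s %| n -> representable A B n.
  elim: s => [|x s IHs] Rs.
    by exists 0 => n _ /=; rewrite dvd0n => /eqP ->.
  have Rx : representable A B x by apply: Rs; rewrite mem_head.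
  have [|M HM] := IHs.
    by move=> y ys; apply: Rs; rewrite inE ys orbT.
  rewrite /=; set d := foldr _ _ _ in HM *.
  have [d0|d_gt0] := posnP d.
    exists 0 => n _; rewrite d0 gcdn0 => /dvdnP[q ->]; exact: RM.
  exists (M + d * x) => n Mn /dvdnP[q nq].
  have [a ad da] := Bezoutr x d_gt0.
  pose u := (d.-1 * (a * q)) %% d.
  have ud : u < d by rewrite ltn_mod.
  have ux : u * x <= n.
    by apply: leq_trans (leq_trans (leq_addl M _) Mn); rewrite leq_mul2r (ltnW ud) orbT.
  rewrite -(subnK ux); apply: RD; last exact: RM.
  apply: HM.
    by rewrite leq_subRL // addnC (leq_trans _ Mn) // leq_add2l leq_mul2r (ltnW ud) orbT.
  have dn : d %| n + a * q * x.
    by rewrite nq (_ : _ + _ = q * (gcdn x d + a * x)) ?dvdn_mull //; nia.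
  have du : d %| u * x + a * q * x.
    rewrite -mulnDl dvdn_mulr // /u /dvdn modnDml.
    by rewrite -[X in _ + X]mul1n -mulnDl addn1 prednK // -/(dvdn _ _) dvdn_mulr.
  by rewrite -(dvdn_addl _ du) addnA subnK.
pose G := [seq compound A B i | i <- iota 0 k.+1].
have [|M HM] := gen G.
  by move=> x /mapP[i]; rewrite mem_iota => /andP[_ ik] ->; exact: Rg.
have Ggcd p i : p %| foldr gcdn 0 G -> i <= k -> p %| compound A B i.
  have aux s : p %| foldr gcdn 0 s -> forall x, x \in s -> p %| x.
    elim: s => //= y s IHs; rewrite dvdn_gcd => /andP[py ps] x.
    by rewrite inE => /orP[/eqP -> //|]; exact: IHs.
  move=> pG ik; apply: (aux _ pG); apply: map_f.
  by rewrite mem_iota.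
have G1 : foldr gcdn 0 G = 1.
  have G_gt0 : 0 < foldr gcdn 0 G.
    rewrite lt0n; apply/eqP => G0.
    have := @Ggcd 0 0; rewrite G0 => /(_ isT isT).
    rewrite dvd0n compound0 => /eqP /eqP; apply/negP; rewrite -lt0n big_nat.
    by rewrite prodn_cond_gt0 // => i /A0.
  apply/eqP; rewrite eqn_leq G_gt0 andbT leqNgt; apply/negP => G2.
  have [p p_pr /Ggcd pg] : exists2 p, prime p & p %| foldr gcdn 0 G.
    by exists (pdiv (foldr gcdn 0 G)); [exact: pdiv_prime|exact: pdiv_dvd].
  have prodP m n (F : nat -> nat) : p %| \prod_(m <= l < n) F l ->
      exists2 l, m <= l < n & p %| F l.
    rewrite big_nat; elim/big_rec: _ => [|l x mln IH].
      by rewrite Euclid_dvd1.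
    by rewrite Euclid_dvdM // => /orP[pF|/IH //]; exists l.
  pose P i := (1 <= i <= k) && (p %| entry A i).
  have exP : exists i, P i.
    have := pg 0 isT; rewrite compound0 => /prodP[l lk pl].
    by exists l; rewrite /P pl -ltnS lk.
  have ubP i : P i -> i <= k by case/andP => /andP[].
  case: (ex_maxnP exP ubP) => i /andP[/andP[i1 ik] pa] imax.
  have := pg i ik; rewrite Euclid_dvdM // => /orP[] /prodP[l /andP[l1 l2] pl].
    have := AB i l l1 l2 ik; rewrite /coprime => /eqP abl.
    by have := dvdn_gcd p (entry A i) (entry B l); rewrite abl pa pl Euclid_dvd1.
  have /imax : P l by rewrite /P pl andbT; lia.
  by rewrite leqNgt l1.
apply: (@sub_finite_set _ _ `I_M) => [n nR|]; last exact: finite_II.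
rewrite /= ltnNge; apply/negP => Mn; apply: nR; apply: HM => //.
by rewrite G1.
Qed.

Lemma finite_U0 (k : nat) (A B : k.-tuple nat) (j : 'I_k.+1) :
  finite_set (U0 A B j).
Proof.
pose N := \sum_(i < k.+1) (entry B i.+1 + entry A i) * compound A B i.
apply: (@sub_finite_set _ _ `I_N.+1) => [n [c [cj cB cA ->]]|].
  rewrite /= ltnS; apply: leq_sum => i _; rewrite leq_mul2r; apply/orP; right.
  case: (ltngtP i j) => [/cB/ltnW h|/cA/ltnW h|/val_inj ->].
  - exact: leq_trans h (leq_addr _ _).
  - exact: leq_trans h (leq_addl _ _).
  - by rewrite cj.
exact: finite_II.
Qed.

(* Main.v *)
(** [U0 A B j] is the set of representable numbers [n] such that [n - g_j] is
    not representable.  Indeed the carries [b_(i+1) g_i = a_(i+1) g_(i+1)],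
    performed upwards below [j] and downwards above [j], write every
    representable number as [u + m g_j] with [u] in [U0 A B j]; and two elements
    of [U0 A B j] congruent modulo [g_j] are equal, because the digit vectors
    number exactly [g_j] and meet all the residue classes.  Consequently
    [{n + g_j : n in NR}] and [{0, ..., g_j - 1}] partition the same set as [NR]
    and [U0 A B j], and summing [f] over this set in both ways gives the
    identity. *)
Require Import Defs.
From mathcomp Require Import all_boot all_order all_algebra.
From mathcomp Require Import all_classical.
From mathcomp Require Import zify.

Local Open Scope nat_scope.
Local Open Scope classical_set_scope.

(** Induction on [n]: the coefficient [e] reached at [g n] is divided by [b n]; the remainder stays
    as a digit and the quotient, times [a n], is carried to [g n.+1]. The last coefficient stays
    unbounded. *)
Lemma carry_digits (g a b c : nat -> nat) (n : nat) :
  (forall i, i < n -> 0 < b i) ->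
  (forall i, i < n -> b i * g i = a i * g i.+1) ->
  exists d e, (forall i, i < n -> d i < b i) /\
    \sum_(0 <= i < n.+1) c i * g i = \sum_(0 <= i < n) d i * g i + e * g n.
Proof.
elim: n => [|n IHn] b0 bg.
  by exists (fun=> 0), (c 0); split=> //; rewrite big_nat1 big_geq.
have [i lt_in|i lt_in|d [e [db sumc]]] := IHn.
- exact/b0/ltnW.
- exact/bg/ltnW.
exists (fun i => if i < n then d i else e %% b n), (e %/ b n * a n + c n.+1).
split=> [i|].
  rewrite ltnS leq_eqVlt; case: ltnP => [lt_in _|_ /orP[/eqP ->|//]].
    exact: db.
  by rewrite ltn_mod b0.
rewrite big_nat_recr //= sumc [in RHS]big_nat_recr //= ltnn.
rewrite [in RHS](@eq_big_nat _ _ _ _ _ _ (fun i => d i * g i)); last first.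
  by move=> i /andP[_ ->].
rewrite {1}(divn_eq e (b n)) !mulnDl -[_ * b n * _]mulnA bg // mulnA; lia.
Qed.

(** This is [carry_digits] under the reflection of indices [i] to [k - i], which exchanges the roles
    of [a] and [b]. *)
Lemma carry_digits_rev (g a b c : nat -> nat) (j k : nat) : j <= k ->
  (forall i, j < i <= k -> 0 < a i) ->
  (forall i, j < i <= k -> a i * g i = b i * g i.-1) ->
  exists d e, (forall i, j < i <= k -> d i < a i) /\
    \sum_(j <= i < k.+1) c i * g i =
    e * g j + \sum_(j.+1 <= i < k.+1) d i * g i.
Proof.
move=> jk a0 ag.
have [i ik|i ik|d [e [da sumc]]] :=
  @carry_digits (fun i => g (k - i)) (fun i => b (k - i)) (fun i => a (k - i))
    (fun i => c (k - i)) (k - j).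
- by apply: a0; lia.
- by rewrite ag; [congr (_ * g _); lia | lia].
exists (fun i => d (k - i)), e; split=> [i ik|].
  by have := da (k - i); rewrite subKn; [apply; lia | lia].
have rev (F : nat -> nat) m : m <= k.+1 ->
    \sum_(m <= i < k.+1) F i = \sum_(0 <= i < k.+1 - m) F (k - i).
  move=> mk; rewrite big_nat_rev -{1}(add0n m) big_addn.
  by apply: eq_big_nat => i ik; congr F; lia.
rewrite !rev ?subSS ?subSn //; last exact: leqW.
rewrite sumc subKn // addnC; congr (_ + _).
by apply: eq_big_nat => i ik; rewrite subKn //; lia.
Qed.

Section CompoundSequence.

Context {k : nat} {A B : k.-tuple nat} (hAB : suitable A B) (j : 'I_k.+1).

Let g := compound A B.

Lemma compound_gt0 i : i <= k -> 0 < g i.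
Proof.
case: hAB => A0 B0 _ ik; rewrite /g /compound muln_gt0.
by apply/andP; split; rewrite big_nat prodn_cond_gt0 // => l lk;
  [apply: B0|apply: A0]; lia.
Qed.

Lemma compound_carry i : i < k ->
  entry B i.+1 * g i = entry A i.+1 * g i.+1.
Proof.
move=> ik; rewrite /g /compound (big_nat_recr i.+1) //=.
by rewrite (@big_ltn _ _ _ i.+1 k.+1) //; lia.
Qed.

Lemma representable_add n m :
  representable A B n -> representable A B (n + m * g j).
Proof.
move=> [c ->]; exists (fun i => c i + (i == j) * m).
rewrite [RHS](eq_bigr (fun i : 'I_k.+1 => c i * g i + (i == j) * m * g i)).
  rewrite big_split /=; congr (_ + _).
  by rewrite (bigD1 j) //= eqxx mul1n big1 ?addn0 // => i /negPf ->.
by move=> i _; rewrite mulnDl.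
Qed.

Lemma U0_representable n : U0 A B j n -> representable A B n.
Proof. by move=> [c [_ _ _ ->]]; exists c. Qed.

Lemma representable_U0_add n : representable A B n ->
  exists u m, U0 A B j u /\ n = u + m * g j.
Proof.
case: hAB => A0 B0 _ [c ->].
have jk : j <= k by rewrite -ltnS.
rewrite (eq_bigr (fun i : 'I_k.+1 => c (inord i) * g i)); last first.
  by move=> i _; rewrite inord_val.
rewrite -(big_mkord xpredT (fun i => c (inord i) * g i)).
(* Cutting after [j] lets the upward overflow [e] absorb [c j]; the downward pass then starts with
   [e] as coefficient of [g j], and its overflow [e'] is the multiple of [g j] sought. *)
rewrite (@big_cat_nat _ _ _ j.+1) //=.
have [i ij|i ij|d [e [dB ->]]] :=
  @carry_digits g (fun i => entry A i.+1) (fun i => entry B i.+1)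
    (fun i => c (inord i)) j.
- by apply: B0; lia.
- by apply: compound_carry; lia.
have [|i ij|[|i] ij|d' [e' [dA sumd']]] :=
  @carry_digits_rev g (entry A) (entry B)
    (fun i => if i == j :> nat then e else c (inord i)) j k.
- by [].
- by apply: A0; lia.
- by lia.
- by rewrite compound_carry //; lia.
pose D i := if i < j then d i else if i == j :> nat then 0 else d' i.
exists (\sum_(i < k.+1) D i * g i), e'; split.
  exists D; rewrite /D; split => // [|i ij|i ij]; first by rewrite ltnn eqxx.
    by rewrite ij; exact: dB.
  by rewrite [i < j]ltnNge (ltnW ij) gtn_eqF //=; apply: dA; rewrite ij -ltnS /=.
rewrite -(big_mkord xpredT (fun i => D i * g i)).
rewrite [in RHS](@big_cat_nat _ _ _ j) ?leqW //= [in RHS](@big_ltn _ _ _ j) //.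
rewrite [D j]/D ltnn eqxx mul0n add0n.
rewrite -addnA -[RHS]addnA; congr (_ + _).
  by apply: eq_big_nat => i /andP[_ ij]; rewrite /D ij.
rewrite [RHS]addnC.
move: sumd'; rewrite (@big_ltn _ _ _ j) // eqxx => sumd'.
transitivity (e' * g j + \sum_(j.+1 <= i < k.+1) d' i * g i).
  rewrite -sumd'; congr (_ + _).
  by apply: eq_big_nat => i /andP[ji _]; rewrite gtn_eqF.
congr (_ + _); apply: eq_big_nat => i /andP[ji _].
by rewrite /D ltnNge (ltnW ji) gtn_eqF.
Qed.

(** The number of values allowed for digit [i]; radix 1 at [j] forces the digit 0 there. *)
Let radix (i : 'I_k.+1) : nat :=
  if i < j then entry B i.+1 else if i == j :> nat then 1 else entry A i.

Lemma prod_radix : \prod_(i < k.+1) radix i = g j.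
Proof.
have jk : j <= k by rewrite -ltnS.
rewrite -(big_mkord xpredT (fun i =>
  if i < j then entry B i.+1 else if i == j :> nat then 1 else entry A i)).
rewrite (@big_cat_nat _ _ _ j) ?leqW //= (@big_ltn _ _ _ j) //.
rewrite ltnn eqxx mul1n /g /compound [in RHS]big_add1 /=; congr (_ * _).
  by apply: eq_big_nat => i /andP[_ ->].
by apply: eq_big_nat => i /andP[ji _]; rewrite ltnNge (ltnW ji) gtn_eqF.
Qed.

Let value (d : {dffun forall i, 'I_(radix i)}) : nat :=
  \sum_(i < k.+1) d i * g i.

Lemma U0_value n : U0 A B j n -> exists d, n = value d.
Proof.
move=> [c [cj cB cA ->]].
have cr i : c i < radix i.
  rewrite /radix; case: (ltngtP i j) => [||/val_inj ->]; last by rewrite cj.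
    exact: cB.
  exact: cA.
exists [ffun i => Ordinal (cr i)].
by apply: eq_bigr => i _; rewrite ffunE.
Qed.

Lemma card_digits : #|{: {dffun forall i, 'I_(radix i)}}| = g j.
Proof.
rewrite card_dep_ffun foldrE big_map big_enum /= -prod_radix.
by apply: eq_bigr => i _; rewrite card_ord.
Qed.

(** Since [NR A B] is finite, each class modulo [g j] contains a representable number, and removing
    multiples of [g j] from it stays in the class. *)
Lemma residue_U0 r : exists2 u, U0 A B j u & u = r %[mod g j].
Proof.
have [M NRM] : exists M, forall n, M <= n -> representable A B n.
  have /finite_seqP[s NRs] := finite_NR hAB.
  exists (\max_(x <- s) x).+1 => n Mn; apply: contrapT => nR.
  have : [set` s] n by rewrite -NRs.
  move=> /= ns.
  by have := @leq_bigmax_seq _ s xpredT id n ns isT; rewrite leqNgt Mn.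
have g0 : 0 < g j by apply: compound_gt0; rewrite -ltnS.
have [|u [m [Uu E]]] := @representable_U0_add (r + M * g j).
  apply: NRM; nia.
exists u => //.
by rewrite -(modnMDl m) addnC -E addnC modnMDl.
Qed.

(** A surjection between finite sets of equal size is injective; it is applied to the map from digit
    vectors to residues modulo [g j]. *)
Lemma U0_inj_mod u v : U0 A B j u -> U0 A B j v -> u = v %[mod g j] -> u = v.
Proof.
have g0 : 0 < g j by apply: compound_gt0; rewrite -ltnS.
pose res d := Ordinal (ltn_pmod (value d) g0).
have res_inj : {in predT &, injective res}.
  apply/imset_injP; rewrite card_digits -[X in _ == X]card_ord -cardsT.
  apply/eqP/eq_card => r; rewrite inE; apply/imsetP.
  have [w /U0_value[d ->] dr] := residue_U0 r.
  by exists d => //; apply/val_inj; rewrite /= dr modn_small.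
move=> /U0_value[d ->] /U0_value[d' ->] dd'; congr value.
by apply: res_inj => //; apply/val_inj.
Qed.

Lemma U0_not_representable_add n :
  representable A B n -> ~ U0 A B j (n + g j).
Proof.
move=> /representable_U0_add[u [m [Uu ->]]] Ung.
have g0 : 0 < g j by apply: compound_gt0; rewrite -ltnS.
(* [n + g j] is [u + m.+1 * g j], congruent to [u]; equality would force [m.+1 * g j = 0]. *)
have := U0_inj_mod _ _ Ung Uu; rewrite -addnA -mulSnr addnC modnMDl => /(_ erefl).
by nia.
Qed.

Lemma representable_sub n :
  representable A B n -> ~ U0 A B j n ->
  exists2 m, representable A B m & n = m + g j.
Proof.
move=> /representable_U0_add[u [[|m] [Uu ->]]].
  by rewrite mul0n addn0.
exists (u + m * g j); last by rewrite mulSnr addnA.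
exact/representable_add/U0_representable.
Qed.

Lemma NR_shift_partition :
  (fun n => n + g j) @` NR A B `|` `I_(g j) = NR A B `|` U0 A B j.
Proof.
apply/seteqP; split=> n /=.
  move=> Hn; case: (pselect (NR A B n)) => [|/contrapT Rn]; first by left.
  right; apply: contrapT => nU; case: (representable_sub _ Rn nU) => m Rm En.
  (* Writing [n = m + g j] with [m] representable excludes both [n < g j] and a shift of a
     non-representable number. *)
  case: Hn => [[m' NRm' En']|]; last by rewrite En; lia.
  by apply: NRm'; rewrite (_ : m' = m) //; lia.
have [ng|gn] := ltnP n (g j); first by right.
move=> H; left; exists (n - g j); last by rewrite subnK.
move=> R; case: H => [|].
  by apply; rewrite -(subnK gn) -[X in _ + X]mul1n; exact: representable_add.
by move: (U0_not_representable_add _ R); rewrite subnK.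
Qed.

End CompoundSequence.

Local Open Scope ring_scope.
Local Open Scope classical_set_scope.

Theorem theorem3p3 (V : zmodType) (k : nat) (A B : k.-tuple nat)
    (hAB : suitable A B) (j : 'I_k.+1) (f : nat -> V) :
  \sum_(n \in NR A B) (f (n + compound A B j)%N - f n) =
  \sum_(n \in U0 A B j) f n - \sum_(0 <= n < compound A B j) f n.
Proof.
have fNR := finite_NR hAB; have fU0 := finite_U0 A B j.
set g := compound A B j.
have part : \sum_(n \in NR A B) f (n + g)%N + \sum_(0 <= n < g) f n =
    \sum_(n \in NR A B) f n + \sum_(n \in U0 A B j) f n.
  rewrite -[in RHS]fsbigU0 //; last first.
    by move=> n [NRn /U0_representable].
  rewrite -(NR_shift_partition hAB) fsbigU0 //.
  - rewrite fsbig_image; last by move=> m n _ _ /addIn.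
    by rewrite big_mkord fsbig_ord.
  - exact: finite_image.
  - by move=> n [[m _ <-]] /=; rewrite ltnNge leq_addl.
(* Adding the sum of [f] over [NR A B] to both sides turns the differences into the shifted sum of
   [part]. *)
apply: (GRing.addrI (\sum_(n \in NR A B) f n)).
rewrite -fsbig_split //= GRing.addrA -part GRing.addrK.
by apply: eq_fsbigr => n _; rewrite GRing.addrC GRing.subrK.
Qed.
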